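(* Let $\Omega=\{1,\dots,d\}^{\mathbb{N}}$ and let $\mu_1\ne\mu_2$ be two different Borel probabilities on $\Omega$. Let $\pi$ be the maximal coupling of $\mu_1$ and $\mu_2$ (the probability on $\Omega\times\Omega$ with marginals $\mu_1,\mu_2$ defined in the context). Then $$|\mu_1-\mu_2|_{tv}=2\,\pi\{(x,y)\in\Omega\times\Omega\,:\,x\neq y\}.$$
   Context: $\Omega$ carries the product topology and its Borel $\sigma$-algebra $\mathcal{B}$. For a finite signed measure $\eta$ on $\Omega$ with $\eta(\Omega)=0$, $|\eta|_{tv}=2\sup_{A\in\mathcal{B}}\eta(A)$. Maximal coupling: put $\lambda=\mu_1+\mu_2$, $g=\frac{d\mu_1}{d\lambda}$, $g'=\frac{d\mu_2}{d\lambda}$, and define the measure $Q$ on $\Omega$ by $dQ=(g\wedge g')\,d\lambda$, where $g\wedge g'$ is the pointwise minimum. Let $\hat Q$ be the push-forward of $Q$ under $\varphi:\Omega\to\Omega\times\Omega$, $\varphi(x)=(x,x)$. Let $\gamma=Q(\Omega)$ (one has $\gamma<1$ because $\mu_1\neq\mu_2$), $\nu_1=\mu_1-Q$, $\nu_2=\mu_2-Q$. Then $$\pi=\hat Q+\frac{\nu_1\otimes\nu_2}{1-\gamma}.$$ *)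

(* Defs.v *)
(* MathComp / MathComp-Analysis *)
From HB Require Import structures.
From mathcomp Require Import all_boot all_order all_algebra.
From mathcomp Require Import all_classical all_reals all_analysis.
From mathcomp Require Import measurable_realfun.

Set Implicit Arguments.
Unset Strict Implicit.
Unset Printing Implicit Defensive.

Import Order.TTheory GRing.Theory Num.Theory.
Import numFieldNormedType.Exports.

Local Open Scope classical_set_scope.
Local Open Scope ring_scope.
Local Open Scope ereal_scope.

(* The alphabet {1, ..., d} is relabelled as 'I_d, with d written n.+1: the
   library's measurable spaces are nonempty, and for d = 0 the space of
   sequences carries no probability anyway. *)
Definition seq_space (n : nat) :=
  prod_topology (fun _ : nat => discrete_topology 'I_n.+1).

HB.instance Definition _ n := Topological.on (seq_space n).
HB.instance Definition _ n := isPointed.Build (seq_space n) (fun=> ord0).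

Definition Omega (n : nat) := g_sigma_algebraType (@open (seq_space n)).

HB.instance Definition _ n := Measurable.on (Omega n).

(* Meaningful for charges of total mass 0. *)
Definition tv_norm d (T : measurableType d) (R : realType)
    (eta : {charge set T -> \bar R}) : \bar R :=
  2%:E * ereal_sup [set eta A | A in measurable].

Section measure_difference.
Context d (T : measurableType d) (R : realType).

(* Measures of the library are nonnegative on all sets, including the
   nonmeasurable ones, where m - q need not be nonnegative. *)
Definition mdiff (m q : set T -> \bar R)
    & (forall A, measurable A -> q A <= m A) : set T -> \bar R :=
  fun A => if A \in measurable then m A - q A else 0.

Variables (m q : {finite_measure set T -> \bar R}).
Hypothesis qm : forall A, measurable A -> q A <= m A.

Local Notation mq := (mdiff qm).

Let mdiff0 : mq set0 = 0.
Proof. by rewrite /mdiff !measure0 sube0 if_same. Qed.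

Let mdiff_ge0 A : 0 <= mq A.
Proof.
rewrite /mdiff; case: ifPn => // /set_mem mA.
by rewrite sube_ge0 ?qm// fin_num_measure.
Qed.

Let mdiff_sigma_additive : semi_sigma_additive mq.
Proof.
move=> F mF tF mU; rewrite /mdiff mem_set//.
have h := @charge_semi_sigma_additive _ _ _
  (cadd (charge_of_finite_measure m) (copp (charge_of_finite_measure q)))
  F mF tF mU.
rewrite [X in X @ _ --> _](_ : _ = (fun k => \sum_(0 <= i < k)
  cadd (charge_of_finite_measure m) (copp (charge_of_finite_measure q)) (F i))) //.
by apply/funext => k; apply: eq_bigr => i _; rewrite mem_set.
Qed.

HB.instance Definition _ := isMeasure.Build _ _ _ mq
  mdiff0 mdiff_ge0 mdiff_sigma_additive.

Let mdiff_fin : fin_num_fun mq.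
Proof.
by move=> A mA; rewrite /mdiff mem_set// fin_numB !fin_num_measure.
Qed.

HB.instance Definition _ := Measure_isFinite.Build _ _ _ mq mdiff_fin.

End measure_difference.

Section maximal_coupling.
Context d (T : measurableType d) (R : realType).
Variables (mu1 mu2 : probability T R).

Definition mc_lambda : set T -> \bar R := measure_add mu1 mu2.

HB.instance Definition _ := Measure.on mc_lambda.

Let lambdaE A : mc_lambda A = mu1 A + mu2 A.
Proof. exact: measure_addE. Qed.

Let lambda_fin : fin_num_fun mc_lambda.
Proof.
move=> A mA.
by rewrite (lambdaE A) fin_numD !fin_num_measure.
Qed.

HB.instance Definition _ := Measure_isFinite.Build _ _ _ mc_lambda lambda_fin.

Lemma mc_lambda_dominates1 : mu1 `<< mc_lambda.
Proof.
apply/null_content_dominatesP => A mA.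
by rewrite [X in X = _ -> _]lambdaE => /eqP; rewrite padde_eq0// => /andP[/eqP].
Qed.

Lemma mc_lambda_dominates2 : mu2 `<< mc_lambda.
Proof.
apply/null_content_dominatesP => A mA.
by rewrite [X in X = _ -> _]lambdaE => /eqP; rewrite padde_eq0// => /andP[_ /eqP].
Qed.

(* Versions of the Radon-Nikodym derivatives that are nonnegative everywhere,
   not only almost everywhere ('d _ '/d _ is an arbitrary version). *)
Definition mc_g1 : T -> \bar R := Radon_Nikodym_SigmaFinite.f mu1 mc_lambda.
Definition mc_g2 : T -> \bar R := Radon_Nikodym_SigmaFinite.f mu2 mc_lambda.

Definition mc_Q : set T -> \bar R :=
  fun A => \int[mc_lambda]_(x in A) mine (mc_g1 x) (mc_g2 x).

Let g1_ge0 x : 0 <= mc_g1 x.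
Proof. exact/Radon_Nikodym_SigmaFinite.f_ge0/mc_lambda_dominates1. Qed.

Let g2_ge0 x : 0 <= mc_g2 x.
Proof. exact/Radon_Nikodym_SigmaFinite.f_ge0/mc_lambda_dominates2. Qed.

Let measurable_g1 : measurable_fun [set: T] mc_g1.
Proof.
apply: (@measurable_int _ _ _ mc_lambda).
exact/Radon_Nikodym_SigmaFinite.f_integrable/mc_lambda_dominates1.
Qed.

Let measurable_g2 : measurable_fun [set: T] mc_g2.
Proof.
apply: (@measurable_int _ _ _ mc_lambda).
exact/Radon_Nikodym_SigmaFinite.f_integrable/mc_lambda_dominates2.
Qed.

Let min_ge0 x : 0 <= mine (mc_g1 x) (mc_g2 x).
Proof. by rewrite le_min g1_ge0 g2_ge0. Qed.

Let measurable_min :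
  measurable_fun [set: T] (fun x => mine (mc_g1 x) (mc_g2 x)).
Proof. exact: measurable_mine. Qed.

Let Q0 : mc_Q set0 = 0.
Proof. exact: integral_set0. Qed.

Let Q_ge0 A : 0 <= mc_Q A.
Proof. exact: integral_ge0. Qed.

Let Q_sigma_additive : semi_sigma_additive mc_Q.
Proof. exact: semi_sigma_additive_nng_induced. Qed.

HB.instance Definition _ := isMeasure.Build _ _ _ mc_Q
  Q0 Q_ge0 Q_sigma_additive.

Lemma mc_Q_le1 A : measurable A -> mc_Q A <= mu1 A.
Proof.
move=> mA; rewrite (Radon_Nikodym_SigmaFinite.f_integral
  mc_lambda_dominates1 mA).
by apply: ge0_le_integral => //; [exact: measurable_funTS
  |exact: measurable_funTS|move=> x _; rewrite ge_min lexx].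
Qed.

Lemma mc_Q_le2 A : measurable A -> mc_Q A <= mu2 A.
Proof.
move=> mA; rewrite (Radon_Nikodym_SigmaFinite.f_integral
  mc_lambda_dominates2 mA).
by apply: ge0_le_integral => //; [exact: measurable_funTS
  |exact: measurable_funTS|move=> x _; rewrite ge_min lexx orbT].
Qed.

Let Q_fin : fin_num_fun mc_Q.
Proof.
move=> A mA; rewrite ge0_fin_numE//.
by rewrite (le_lt_trans (mc_Q_le1 mA))// ltey_eq fin_num_measure.
Qed.

HB.instance Definition _ := Measure_isFinite.Build _ _ _ mc_Q Q_fin.

Definition mc_diag (x : T) : T * T := (x, x).

Lemma measurable_mc_diag : measurable_fun [set: T] mc_diag.
Proof. exact: measurable_fun_pair. Qed.

Definition mc_Qhat : set (T * T) -> \bar R := pushforward mc_Q mc_diag.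

Let Qhat0 : mc_Qhat set0 = 0.
Proof. exact: (measure0 mc_Q). Qed.

Let Qhat_ge0 A : 0 <= mc_Qhat A.
Proof. exact: (measure_ge0 mc_Q). Qed.

Let Qhat_sigma_additive : semi_sigma_additive mc_Qhat.
Proof.
rewrite /mc_Qhat; apply: measure_semi_sigma_additive.
exact: measurable_mc_diag.
Qed.

HB.instance Definition _ := isMeasure.Build _ _ _ mc_Qhat
  Qhat0 Qhat_ge0 Qhat_sigma_additive.

Definition mc_gamma : R := fine (mc_Q [set: T]).

Definition mc_nu1 : set T -> \bar R := mdiff mc_Q_le1.
Definition mc_nu2 : set T -> \bar R := mdiff mc_Q_le2.

HB.instance Definition _ := FiniteMeasure.on mc_nu1.
HB.instance Definition _ := FiniteMeasure.on mc_nu2.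

Lemma mc_scale_ge0 : (0 <= (1 - mc_gamma)^-1)%R.
Proof.
rewrite invr_ge0 subr_ge0 -lee_fin fineK ?fin_num_measure//.
by rewrite (le_trans (mc_Q_le1 measurableT))// probability_setT.
Qed.

Definition maximal_coupling : set (T * T) -> \bar R :=
  measure_add mc_Qhat (mscale (NngNum mc_scale_ge0) (mc_nu1 \x mc_nu2)).

HB.instance Definition _ := Measure.on maximal_coupling.

End maximal_coupling.

(* Main.v *)
(* With B = {g1 > g2} for the two densities, the excess nu1 = mu1 - Q is
   carried by B and nu2 = mu2 - Q by the complement of B.  Hence the sup of
   mu1 - mu2 = nu1 - nu2 is attained at B, with value the common total mass
   1 - gamma.  The diagonal part of the coupling ignores {x <> y}, while
   nu1 (x) nu2 lives on B x ~B, which is off the diagonal, so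
   pi {x <> y} = (1 - gamma)^2 / (1 - gamma). *)
Require Import Defs.
From HB Require Import structures.
From mathcomp Require Import all_boot all_order all_algebra.
From mathcomp Require Import all_classical all_reals all_analysis.
From mathcomp Require Import measurable_realfun.

Import Order.TTheory GRing.Theory Num.Theory.

Local Open Scope classical_set_scope.
Local Open Scope ring_scope.
Local Open Scope ereal_scope.

Section excess_measures.
Context d (T : measurableType d) (R : realType).
Variables mu1 mu2 : probability T R.

Local Notation g1 := (mc_g1 mu1 mu2).
Local Notation g2 := (mc_g2 mu1 mu2).
Local Notation Q := (mc_Q mu1 mu2).
Local Notation nu1 := (mc_nu1 mu1 mu2).
Local Notation nu2 := (mc_nu2 mu1 mu2).
Local Notation gamma := (mc_gamma mu1 mu2).
Local Notation B := [set x | g2 x < g1 x].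

Lemma mc_nu1E A : measurable A -> nu1 A = mu1 A - Q A.
Proof. by move=> mA; rewrite /mc_nu1 /mdiff mem_set. Qed.

Lemma mc_nu2E A : measurable A -> nu2 A = mu2 A - Q A.
Proof. by move=> mA; rewrite /mc_nu2 /mdiff mem_set. Qed.

Lemma mc_nu1T : nu1 [set: T] = (1 - gamma)%:E.
Proof.
by rewrite mc_nu1E// probability_setT EFinB fineK// fin_num_measure.
Qed.

Lemma mc_nu2T : nu2 [set: T] = (1 - gamma)%:E.
Proof.
by rewrite mc_nu2E// probability_setT EFinB fineK// fin_num_measure.
Qed.

Lemma measurable_mc_g1 : measurable_fun [set: T] g1.
Proof.
apply: (@measurable_int _ _ _ (mc_lambda mu1 mu2)).
exact/Radon_Nikodym_SigmaFinite.f_integrable/mc_lambda_dominates1.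
Qed.

Lemma measurable_mc_g2 : measurable_fun [set: T] g2.
Proof.
apply: (@measurable_int _ _ _ (mc_lambda mu1 mu2)).
exact/Radon_Nikodym_SigmaFinite.f_integrable/mc_lambda_dominates2.
Qed.

Lemma measurable_mc_gt : measurable B.
Proof.
rewrite -[X in measurable X]setTI.
by apply: measurable_lte; [|exact: measurable_mc_g2|exact: measurable_mc_g1].
Qed.

(** Off [B] the minimum of the two densities is [g1], so [Q] and [mu1] integrate the same function
    there. *)
Lemma mc_nu1_gtC : nu1 (~` B) = 0.
Proof.
have mBC := measurableC measurable_mc_gt.
rewrite mc_nu1E//; suff -> : Q (~` B) = mu1 (~` B).
  by rewrite subee// fin_num_measure.
rewrite (Radon_Nikodym_SigmaFinite.f_integral
  (@mc_lambda_dominates1 _ _ _ mu1 mu2) mBC).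
apply: eq_integral => x /[!inE] /= /negP.
by rewrite -leNgt => /min_idPl.
Qed.

(** Symmetric: on [B] the minimum is [g2]. *)
Lemma mc_nu2_gt : nu2 B = 0.
Proof.
have mB := measurable_mc_gt.
rewrite mc_nu2E//; suff -> : Q B = mu2 B.
  by rewrite subee// fin_num_measure.
rewrite (Radon_Nikodym_SigmaFinite.f_integral
  (@mc_lambda_dominates2 _ _ _ mu1 mu2) mB).
by apply: eq_integral => x /[!inE] /= /ltW /min_idPr.
Qed.

Lemma mc_nu1_gt : nu1 B = (1 - gamma)%:E.
Proof.
have mB := measurable_mc_gt.
rewrite -mc_nu1T -(setUv B) measureU ?setICr//; last exact: measurableC.
by rewrite [X in _ + X]mc_nu1_gtC adde0.
Qed.

Lemma mc_nu2_gtC : nu2 (~` B) = (1 - gamma)%:E.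
Proof.
have mB := measurable_mc_gt.
rewrite -mc_nu2T -(setUv B) measureU ?setICr//; last exact: measurableC.
by rewrite [X in X + _]mc_nu2_gt add0e.
Qed.

Lemma tv_norm_prob :
  tv_norm (cadd (charge_of_finite_measure mu1)
                (copp (charge_of_finite_measure mu2))) =
  2%:E * (1 - gamma)%:E.
Proof.
have etaE A : measurable A -> cadd (charge_of_finite_measure mu1)
    (copp (charge_of_finite_measure mu2)) A = nu1 A - nu2 A.
  move=> mA; rewrite mc_nu1E// mc_nu2E//.
  rewrite [LHS](_ : _ = mu1 A - mu2 A)//.
  (* All three values are finite, so [Q A] can be cancelled in the reals. *)
  rewrite -(fineK (fin_num_measure mu1 A mA)).
  rewrite -(fineK (fin_num_measure mu2 A mA)).
  rewrite -(fineK (fin_num_measure Q A mA)) -!EFinB.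
  by rewrite opprB addrA subrK.
congr (_ * _); apply/eqP; rewrite eq_le; apply/andP; split.
  apply/ge_ereal_sup => _ [A mA <-]; rewrite [leLHS]etaE// -mc_nu1T.
  (* Dropping the nonnegative term [nu2 A] leaves only monotonicity of [nu1]. *)
  rewrite leeBlDr ?fin_num_measure//.
  by apply: (le_trans (le_measure _ _ _ (@subsetT _ A))); rewrite ?inE ?leeDl.
apply: ereal_sup_ubound; exists B; first exact: measurable_mc_gt.
rewrite [LHS]etaE; last exact: measurable_mc_gt.
by rewrite mc_nu1_gt mc_nu2_gt sube0.
Qed.

(** Measurability of the off-diagonal set is assumed because it can fail in a general measurable
    space [T]; for [Omega] it is proved below. *)
Lemma maximal_coupling_neq :
  measurable [set z : T * T | z.1 <> z.2] ->
  maximal_coupling mu1 mu2 [set z | z.1 <> z.2] = (1 - gamma)%:E.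
Proof.
set D := [set z | _] => mD.
have mB := measurable_mc_gt.
have sq : (nu1 \x nu2) D = (1 - gamma)%:E * (1 - gamma)%:E.
  apply/eqP; rewrite eq_le; apply/andP; split.
    rewrite -{1}mc_nu1T -{1}mc_nu2T -product_measure1E// setXTT.
    by apply: le_measure; rewrite ?inE.
  rewrite -{1}mc_nu1_gt -{1}mc_nu2_gtC -product_measure1E//; last first.
    exact: measurableC.
  apply: le_measure; rewrite ?inE//.
    by apply: measurableX => //; exact: measurableC.
  by move=> [x y] [Bx By]; rewrite /D /= => xy; apply: By; rewrite -xy.
rewrite /maximal_coupling measure_addE.
rewrite [X in X + _](_ : _ = 0); last first.
  rewrite [LHS](_ : _ = Q (@mc_diag _ T @^-1` D))//.
  (* No point [(x, x)] lies in [D]. *)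
  rewrite (_ : _ @^-1` _ = set0) ?measure0//.
  by apply/seteqP; split.
rewrite add0e [LHS](_ : _ = ((1 - gamma)^-1)%:E * (nu1 \x nu2) D)//.
rewrite sq -!EFinM mulrA.
(* For gamma = 1 the quotient by 0 is 0, so the identity still holds. *)
have [->|gamma_neq1] := eqVneq (1 - gamma)%R 0%R; first by rewrite mulr0.
by rewrite mulVf// mul1r.
Qed.

End excess_measures.

Lemma measurable_cylinder n (i : nat) (a : 'I_n.+1) :
  measurable [set x : Omega n | x i = a].
Proof.
apply: sub_sigma_algebra.
have : open (proj i @^-1` [set a] : set (seq_space n)).
  apply: open_comp => [x _|]; first exact: proj_continuous.
  exact: discrete_open.
by [].
Qed.

(** The sigma-algebra on pairs is generated by measurable rectangles. Distinct sequences differ at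
    some coordinate [i]; sorting by the letter [a] that the first one has there gives a countable
    union of rectangles. *)
Lemma measurable_neq_Omega n :
  measurable [set z : Omega n * Omega n | z.1 <> z.2].
Proof.
rewrite (_ : [set z | _] = \bigcup_i \bigcup_(a in [set: 'I_n.+1])
    ([set x | x i = a] `*` ~` [set x | x i = a])).
  apply: bigcupT_measurable => i; apply: fin_bigcup_measurable => // a _.
  by apply: measurableX; [|apply: measurableC]; exact: measurable_cylinder.
apply/seteqP; split=> [[x y] /= xy|[x y] [i _ [a _ [/= xa ya]]] xy].
  have [i xyi] : exists i, x i <> y i.
    by apply/existsNP => xy'; apply: xy; exact: funext.
  by exists i => //; exists (x i) => //; split => //= /esym.
by apply: ya; rewrite -xy.
Qed.

Theorem theorem2 (R : realType) (n : nat) (mu1 mu2 : probability (Omega n) R)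
    (mu1_neq_mu2 : ~ (forall A, measurable A -> mu1 A = mu2 A)) :
  tv_norm (cadd (charge_of_finite_measure mu1)
                (copp (charge_of_finite_measure mu2))) =
  2%:E * maximal_coupling mu1 mu2 [set z | z.1 <> z.2].
Proof.
rewrite tv_norm_prob maximal_coupling_neq//.
exact: measurable_neq_Omega.
Qed.
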